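(* Let $H$ be a finite abelian group and let $G\le H^{\mathbb Z}$ be an order controllable group shift over $H$. Then there is a noncatastrophic isomorphic encoder for $G$. As a consequence, $G$ is algebraically and topologically conjugate to a full group shift.
   Context: $H^{\mathbb Z}$ carries componentwise addition and the product topology, where the finite group $H$ is discrete. The backward shift is $\sigma[x](i)=x(i+1)$. A group shift over $H$ is a closed subgroup $G\le H^{\mathbb Z}$ with $\sigma(G)=G$. A full group shift is a group of the form $K^{\mathbb Z}$, with $K$ a finite group, equipped with its shift $\sigma$. For $x\in H^{\mathbb Z}$, $\mathrm{supp}(x)=\{i\in\mathbb Z: x(i)\neq 0\}$. The finite subcode $G_f$ of $G$ is the subgroup of all elements of $G$ with finite support. For $A\subseteq \mathbb Z$, $x_{|A}$ is the restriction of $x$ to $A$ (an element of $H^A$, whose order is its order in the group $H^A$). Intervals are intervals of integers. $G$ is order controllable if there is a positive integer $n_o$ such that for each $g\in G$ there exists $g_1\in G$ with $g_{1|(-\infty,0]}=g_{|(-\infty,0]}$, $\mathrm{supp}(g_1)\subseteq(-\infty,n_o]$, and such that $\mathrm{order}(g_{1|[1,n_o]})$ divides $\mathrm{order}(g_{|[1,n_o]})$. A homomorphic encoder for $G$ is a continuous homomorphism $\Phi:\prod_{i\in\mathbb Z}H_i\to G$ from a full direct product of topological groups $H_i$ (with the product topology) onto $G$. It is noncatastrophic if it is one-to-one and $\Phi(\bigoplus_{i\in\mathbb Z}H_i)=G_f$. It is isomorphic if it is an isomorphism of topological groups. Two group shifts $G,\bar G$ are algebraically and topologically conjugate if there is a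 topological group isomorphism $\Phi:G\to\bar G$ with $\sigma\circ\Phi=\Phi\circ\sigma$. *)

(* Defs.v *)
From HB Require Import structures.
From mathcomp Require Import all_boot all_order all_fingroup all_algebra.
From mathcomp Require Import all_classical all_reals all_analysis.

Set Implicit Arguments.
Unset Strict Implicit.
Unset Printing Implicit Defensive.

Import Order.TTheory GRing.Theory Num.Theory.

Local Open Scope classical_set_scope.
Local Open Scope ring_scope.

(* Elements of H^Z are plain functions int -> H, with their pointwise Zmodule  *)
(* structure; the library puts no canonical topology on them, so topological   *)
(* notions are stated through this copy, where H is discrete.                  *)
Notation biseq H := {ptws int -> discrete_topology H}.

Definition bshift (H : Type) (x : int -> H) : int -> H := fun i => x (i + 1).

Definition supp (T : int -> zmodType) (x : forall i, T i) : set int :=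
  [set i | x i != 0].

Record group_shift (H : finZmodType) (G : set (int -> H)) : Prop := GroupShift {
  group_shift_closed : closed (G : set (biseq H));
  group_shift_subgroup : zmod_closed (mem G);
  group_shift_invariant : @bshift H @` G = G
}.

Definition full_group_shift (K : finZmodType) : set (int -> K) := [set: int -> K].

Definition finite_subcode (H : finZmodType) (G : set (int -> H)) :
    set (int -> H) :=
  [set x | G x /\ finite_set (supp x)].

(* The restriction of x to the integer interval [1, n], as a row vector whose  *)
(* entry k : 'I_n is x (k + 1). 'rV[H]_n is a finite group under entrywise     *)
(* addition, so #[window n x] is the order of the restriction in H^[1, n].     *)
Definition window (H : finZmodType) (n : nat) (x : int -> H) : 'rV[H]_n :=
  \row_(k < n) x (k.+1)%:Z.

Definition order_controllable (H : finZmodType) (G : set (int -> H)) : Prop :=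
  exists2 n : nat, (0 < n)%N &
    forall g, G g -> exists g1 : int -> H,
      [/\ G g1,
          forall i : int, i <= 0 -> g1 i = g i,
          supp g1 `<=` [set i | i <= n%:Z] &
          (#[window n g1]%g %| #[window n g]%g)%N].

Section Encoders.

Variables (H : finZmodType) (G : set (int -> H)).
(* The factors are taken abelian, as the domain of a one-to-one homomorphism   *)
(* into H^Z necessarily is.                                                    *)
Variables (T : int -> topologicalZmodType).
Variable (Phi : (forall i, T i) -> (int -> H)).

Record homomorphic_encoder : Prop := HomomorphicEncoder {
  encoder_continuous : continuous (Phi : prod_topology T -> biseq H);
  encoder_additive : forall x y, Phi (fun i => x i + y i) = Phi x + Phi y;
  encoder_onto : range Phi = G
}.

Definition direct_sum : set (forall i, T i) := [set x | finite_set (supp x)].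

Definition noncatastrophic : Prop :=
  injective Phi /\ Phi @` direct_sum = finite_subcode G.

(* G carries the topology induced by H^Z: the inverse only has to be           *)
(* continuous within G.                                                        *)
Definition isomorphic_encoder : Prop :=
  homomorphic_encoder /\
  exists Psi : (int -> H) -> (forall i, T i),
    cancel Phi Psi /\
    {within (G : set (biseq H)), continuous (Psi : biseq H -> prod_topology T)}.

End Encoders.

(* Phi and Psi are total maps of which only the restrictions to G and G'       *)
(* matter; as Phi @` G = G', being a left inverse of Phi on G makes Psi a      *)
(* two-sided inverse G' -> G.                                                  *)
Record conjugacy (H K : finZmodType) (G : set (int -> H)) (G' : set (int -> K))
    (Phi : (int -> H) -> (int -> K)) (Psi : (int -> K) -> (int -> H)) : Prop :=
  Conjugacy {
    conjugacy_onto : Phi @` G = G';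
    conjugacy_inverse : forall x, G x -> Psi (Phi x) = x;
    conjugacy_additive :
      forall x y, G x -> G y -> Phi (x + y) = Phi x + Phi y;
    conjugacy_continuous :
      {within (G : set (biseq H)), continuous (Phi : biseq H -> biseq K)};
    conjugacy_inverse_continuous :
      {within (G' : set (biseq K)), continuous (Psi : biseq K -> biseq H)};
    conjugacy_shift : forall x, G x -> Phi (bshift x) = bshift (Phi x)
  }.

Definition conjugate_shifts (H K : finZmodType)
    (G : set (int -> H)) (G' : set (int -> K)) : Prop :=
  exists Phi Psi, conjugacy G G' Phi Psi.

(* Main.v *)
Require Import Defs.
From HB Require Import structures.
From mathcomp Require Import all_boot all_order all_fingroup all_algebra.
From mathcomp Require Import all_classical all_reals all_analysis.
From mathcomp Require Import cyclic zify.

Set Implicit Arguments.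
Unset Strict Implicit.
Unset Printing Implicit Defensive.

Import Order.TTheory GRing.Theory Num.Theory.

Local Open Scope classical_set_scope.
Local Open Scope ring_scope.

(** Let M be the finite subcode of G, on which the integer polynomials act
    with 'X as the right shift; M is stable under the inverse shift as well, so
    it is a module over the Laurent polynomials. The theorem amounts to a
    decomposition of M: a finite group K of finitely supported words such that
    every element of M is, in exactly one way, a finite sum of shifted words
    of K.

    The algebraic core is the existence of a basis of M: finitely many g_i in
    M, of orders o_i, such that M is the direct sum of the modules that they
    generate and each of these is free over Z/o_i[X, X^-1]
    ([laurent_basis_exists]). It goes by induction on the exponent of M. For a
    prime p dividing the exponent, a basis of pM can be lifted to M through
    multiplication by p, and then completed by a basis of M[p] modulo
    M[p] /\ pM, where M[p] is the p-torsion of M ([torsion_step]). That quotient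
    is a module over the principal ideal domain F_p[X, X^-1]; it is finitely
    generated and torsion-free, hence free, and Euclidean division finds a
    basis ([independent_generators]).

    Order controllability provides both properties at every stage. The
    condition on orders says that k times the controlled sequence vanishes on
    the window as soon as k times the original one does; therefore control is
    inherited by kM and by its p-torsion ([oc_multiples], [oc_torsion]). Control
    yields generators of bounded width ([oc_laurent_generated]). On a sequence
    that vanishes on the window, control with exponent 1 says that the past of
    the sequence lies in the module by itself ([oc_cutoff]). This gives
    torsion-freeness: if p x = 0, q is nonzero modulo p and q x is in pM, then
    pM also contains the difference of x and a word that starts as far to the
    right as desired, and the gap between the two makes it possible to cut x off
    ([oc_saturated]).

    The basis turns into a sliding block encoder from K^Z ([oc_code]). Its
    inverse has a bounded window too ([code_local]): a word of M that vanishes on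
    a long window is the sum of a past and of a future word of M, and the
    coordinates of a word stay close to its support since M is generated by
    words of bounded width. As G is closed and M is dense in it by
    controllability, both maps extend to G, and locality makes them
    continuous, mutually inverse and compatible with finite supports. *)

(** * Integer polynomials modulo a prime *)

Definition redp (p : nat) (q : {poly int}) : {poly 'F_p} :=
  map_poly (intr : int -> 'F_p) q.

Section ReductionModP.

Variables (p : nat) (p_pr : prime p).

Lemma redp_surj (b : {poly 'F_p}) : exists q, redp p q = b.
Proof.
exists (\poly_(i < size b) (nat_of_ord b`_i)%:Z).
apply/polyP => i; rewrite coef_map coef_poly /=.
case: ltnP => [_|le_b_i]; last by rewrite nth_default.
by rewrite -pmulrn natr_Zp.
Qed.

Lemma redp_eq0 (q : {poly int}) : redp p q = 0 -> exists c, q = c *+ p.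
Proof.
move=> q0; exists (\poly_(i < size q) (q`_i %/ p)%Z).
apply/polyP => i; rewrite coefMn coef_poly.
case: ltnP => [_|le_q_i]; last by rewrite nth_default // mul0rn.
have /eqP: (redp p q)`_i = 0 by rewrite q0 coef0.
rewrite coef_map /= -(dvdz_pcharf (pchar_Fp p_pr)) => p_dvd.
by rewrite -mulr_natr natz divzK.
Qed.

(** On elements killed by p the action of integer polynomials factors through
    F_p[X], which need not act on the ambient module. *)
Lemma redpZ (V : lmodType {poly int}) (a b : {poly int}) (x : V) :
  x *+ p = 0 -> redp p a = redp p b -> a *: x = b *: x.
Proof.
move=> px0 ab; have [|c abc] := @redp_eq0 (a - b).
  by rewrite /redp rmorphB /= -/(redp p a) -/(redp p b) ab subrr.
apply/eqP; rewrite -subr_eq0 -scalerBl abc -mulr_natr -scalerA.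
by rewrite scaler_nat px0 scaler0.
Qed.

End ReductionModP.

(** * Submodules and spans *)

Definition submodule (R : nzRingType) (V : lmodType R) (M : set V) : Prop :=
  M 0 /\ forall a x y, M x -> M y -> M (a *: x + y).

(** The preimage of the submodule that x generates in the quotient by N; this
    avoids forming the quotient module. *)
Definition span_mod (R : nzRingType) (V : lmodType R) (N : set V)
    (I : finType) (x : I -> V) : set V :=
  [set z | exists c : I -> R, N (z - \sum_i c i *: x i)].

Section Submodule.

Variables (R : nzRingType) (V : lmodType R) (M : set V).
Hypothesis subM : submodule M.

Lemma submodule0 : M 0. Proof. by case: subM. Qed.

Lemma submoduleD x y : M x -> M y -> M (x + y).
Proof. by case: subM => _ h Mx My; rewrite -[x]scale1r; apply: h. Qed.

Lemma submoduleZ a x : M x -> M (a *: x).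
Proof. by case: subM => M0 h Mx; rewrite -[_ *: _]addr0; apply: h. Qed.

Lemma submoduleN x : M x -> M (- x).
Proof. by rewrite -scaleN1r; apply: submoduleZ. Qed.

Lemma submoduleB x y : M x -> M y -> M (x - y).
Proof. by move=> Mx My; apply: submoduleD => //; apply: submoduleN. Qed.

Lemma submoduleMn x k : M x -> M (x *+ k).
Proof. by rewrite -scaler_nat; apply: submoduleZ. Qed.

Lemma submodule_sum (I : Type) (r : seq I) (P : pred I) (x : I -> V) :
  (forall i, P i -> M (x i)) -> M (\sum_(i <- r | P i) x i).
Proof.
by move=> Mx; apply: big_ind => //; [apply: submodule0|apply: submoduleD].
Qed.

Lemma submodule_span (I : finType) (x : I -> V) : submodule (span_mod M x).
Proof.
split.
  exists (fun=> 0); rewrite big1 ?subr0; first exact: submodule0.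
  by move=> i _; rewrite scale0r.
move=> a y z [c Mc] [d Md]; exists (fun i => a * c i + d i).
have -> : \sum_i (a * c i + d i) *: x i =
    a *: (\sum_i c i *: x i) + \sum_i d i *: x i.
  rewrite scaler_sumr -big_split /=; apply: eq_bigr => i _.
  by rewrite scalerDl scalerA.
rewrite opprD addrACA -scalerBr.
by apply: submoduleD => //; apply: submoduleZ.
Qed.

Lemma span_gen (I : finType) (x : I -> V) i : span_mod M x (x i).
Proof.
exists (fun j => (j == i)%:R); rewrite (bigD1 i) //= eqxx scale1r big1 ?addr0.
  by rewrite subrr; apply: submodule0.
by move=> j /negPf ->; rewrite scale0r.
Qed.

Lemma span_base (I : finType) (x : I -> V) z : M z -> span_mod M x z.
Proof.
move=> Mz; exists (fun=> 0); rewrite big1 ?subr0 // => i _.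
by rewrite scale0r.
Qed.

Lemma span_trans (I J : finType) (x : I -> V) (y : J -> V) :
  (forall i, span_mod M y (x i)) -> span_mod M x `<=` span_mod M y.
Proof.
move=> yx z [c Mc]; have subY := submodule_span y.
rewrite -[z](subrK (\sum_i c i *: x i)).
have Mz := span_base y Mc.
case: subY => y0 yD; rewrite -[z - _]scale1r; apply: (yD) => //.
apply: big_ind => // [u v ? ?|i _]; first by rewrite -[u]scale1r; apply: yD.
by rewrite -[_ *: _]addr0; apply: yD.
Qed.

End Submodule.

(** * Independent generators modulo a saturated submodule *)

Section EuclideanReduction.

Variables (V : lmodType {poly int}) (p : nat) (p_pr : prime p).
Variables (U N : set V).
Hypotheses (subU : submodule U) (subN : submodule N).
Hypothesis pU : forall x, U x -> x *+ p = 0.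
Hypothesis satN :
  forall q x, U x -> redp p q != 0 -> N (q *: x) -> N x.

(** Zero members are allowed in an independent family: a generator that turns
    out to be redundant is replaced by 0, so that the index type never
    changes. *)
Definition independent_mod (I : finType) (x : I -> V) : Prop :=
  forall c : I -> {poly int}, N (\sum_i c i *: x i) ->
    forall i, x i = 0 \/ redp p (c i) = 0.

(** One step of Euclidean division: each coefficient c i is divided by c j
    modulo p, and the quotients are absorbed in the j-th generator. *)
Lemma relation_reduce (I : finType) (x : I -> V) (c : I -> {poly int}) (j : I) :
    (forall i, U (x i)) -> redp p (c j) != 0 ->
  exists (x' : I -> V) (c' : I -> {poly int}),
    [/\ U (x' j), forall i, i != j -> x' i = x i, forall i, span_mod N x' (x i),
        \sum_i c' i *: x' i = \sum_i c i *: x i & c' j = c j /\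
        forall i, i != j -> (size (redp p (c' i)) < size (redp p (c j)))%N].
Proof.
move=> Ux cj0.
have /choice [q cq] : forall i, exists qr : {poly int} * {poly int},
    redp p (c i) = redp p (qr.1 * c j + qr.2) /\
    (size (redp p qr.2) < size (redp p (c j)))%N.
  move=> i; have [a ra] := redp_surj (redp p (c i) %/ redp p (c j)).
  have [b rb] := redp_surj (redp p (c i) %% redp p (c j)).
  exists (a, b); rewrite /= rb ltn_modp; split=> //.
  rewrite {1}(divp_eq (redp p (c i)) (redp p (c j))) -ra -rb.
  by rewrite /redp rmorphD rmorphM.
pose x' i := if i == j then x j + \sum_(k | k != j) (q k).1 *: x k else x i.
pose c' i := if i == j then c j else (q i).2.
have x'j : x' j = x j + \sum_(k | k != j) (q k).1 *: x k by rewrite /x' eqxx.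
have x'i i : i != j -> x' i = x i by rewrite /x' => /negPf ->.
exists x', c'; split => //; last first.
- by rewrite /c' eqxx; split=> // i /negPf ->; apply: (cq i).2.
- rewrite (bigD1 j) //= [RHS](bigD1 j) //= x'j /c' eqxx scalerDr -addrA.
  congr (_ + _); rewrite scaler_sumr -big_split /=; apply: eq_bigr => i ij.
  rewrite (negPf ij) x'i // (redpZ p_pr (pU (Ux i)) (cq i).1).
  by rewrite scalerDl scalerA mulrC.
- move=> i; have [->|ij] := eqVneq i j; last first.
    by rewrite -x'i //; apply: span_gen.
  have -> : x j = x' j - \sum_(k | k != j) (q k).1 *: x' k.
    rewrite x'j; under [X in _ - X]eq_bigr => k kj do rewrite x'i //.
    by rewrite addrK.
  have subS := submodule_span subN x'.
  apply: (submoduleB subS); first exact: span_gen.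
  apply: (submodule_sum subS) => k _; apply: (submoduleZ subS).
  exact: span_gen.
- rewrite x'j; apply: (submoduleD subU) => //.
  by apply: (submodule_sum subU) => k _; apply: (submoduleZ subU).
Qed.

(** Finitely generated torsion-free modules over a Euclidean ring are free, in
    the form of a descent. Among the relations that violate independence, the
    size of some nonzero coefficient at a nonzero generator decreases under
    [relation_reduce] until all the other terms vanish; then saturation puts the
    j-th generator in N and the number of nonzero generators drops. *)
Lemma independent_generators (I : finType) (x : I -> V) :
    (forall i, U (x i)) ->
  exists y : I -> V, [/\ forall i, U (y i),
    forall i, span_mod N y (x i) & independent_mod y].
Proof.
move: {2}#|_| (leqnn #|[pred i | x i != 0]|) => n.
elim: n x => [|n IHn] x le_n Ux.
  exists x; split=> // [i|c _ i]; first exact: span_gen.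
  left; apply/eqP/negPn/negP => xi0.
  move: le_n; rewrite leqn0 => /eqP/card0_eq/(_ i).
  by rewrite inE xi0.
suff rel (d : nat) (z : I -> V) (c : I -> {poly int}) (j : I) :
    (forall i, U (z i)) -> (#|[pred i | (z i != 0)%R]| <= n.+1)%N ->
    z j != 0 -> redp p (c j) != 0 -> (size (redp p (c j)) <= d)%N ->
    N (\sum_i c i *: z i) ->
    exists y : I -> V, [/\ forall i, U (y i),
      forall i, span_mod N y (z i) & independent_mod y].
  have [xind|] := pselect (independent_mod x).
    by exists x; split=> // i; apply: span_gen.
  move=> /existsNP[c /not_implyP[Nc /existsNP[j /not_orP[xj cj]]]].
  by apply: (rel _ x c j _ _ _ _ (leqnn _)) => //; apply/eqP.
elim: d z c j => [|d IHd] z c j Uz le_z zj cj le_d Nc.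
  by move: le_d cj; rewrite leqn0 size_poly_eq0 => ->.
have [z' [c' [Uz'j z'i zz' sum_c' [c'j lt_c']]]] := relation_reduce Uz cj.
have Uz' i : U (z' i) by have [->|/z'i ->] := eqVneq i j.
have card_z' : (#|[pred i | (z' i != 0)%R]| <= n.+1)%N.
  apply: leq_trans le_z; apply: subset_leq_card; apply/fintype.subsetP => i.
  rewrite !inE; by have [->|/z'i ->] := eqVneq i j.
have [[i [ij z'i0 c'i]]|noi] :=
    pselect (exists i, [/\ i != j, z' i != 0 & redp p (c' i) != 0]).
  have [||y [Uy yz' yind]] := IHd z' c' i Uz' card_z' z'i0 c'i.
  - by rewrite -ltnS (leq_trans (lt_c' i ij)).
  - by rewrite sum_c'.
  exists y; split=> // k; exact: span_trans yz' _ (zz' k).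
have Nz'j : N (z' j).
  apply: (satN (Uz' j) cj); move: Nc; rewrite -sum_c' (bigD1 j) //= c'j.
  rewrite big1 ?addr0 // => i ij.
  have [->|z'i0] := eqVneq (z' i) 0; first by rewrite scaler0.
  have [|c'i] := eqVneq (redp p (c' i)) 0; last by case: noi; exists i.
  move=> c'i; rewrite (@redpZ p p_pr V (c' i) 0) ?scale0r ?(pU (Uz' i)) //.
  by rewrite c'i /redp rmorph0.
pose z'' i := if i == j then 0 else z' i.
have [|i|y [Uy yz'' yind]] := IHn z''.
- rewrite -ltnS; apply: leq_trans le_z; apply: proper_card.
  apply/properP; split; last by exists j; rewrite !inE ?zj // /z'' eqxx eqxx.
  apply/fintype.subsetP => i; rewrite !inE /z''.
  by have [->|/z'i ->] := eqVneq i j; first by rewrite eqxx.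
- by rewrite /z''; case: eqP => // _; apply: submodule0.
exists y; split=> // k; apply: span_trans (zz' k) => // i.
have [->|ij] := eqVneq i j; first exact: span_base.
by have := yz'' i; rewrite /z'' (negPf ij).
Qed.

End EuclideanReduction.

(** * Bases of torsion modules over the Laurent polynomials *)

Definition multiples (V : zmodType) (k : nat) (M : set V) : set V :=
  [set x *+ k | x in M].

Definition torsion (V : zmodType) (k : nat) (M : set V) : set V :=
  [set x | M x /\ x *+ k = 0].

(** The span over the Laurent polynomials, without inverting 'X: membership is
    tested after multiplication by some power of 'X. *)
Definition laurent_span (R : nzRingType) (V : lmodType {poly R})
    (I : finType) (x : I -> V) : set V :=
  [set z | exists k, span_mod [set 0] x ('X^k *: z)].

Definition laurent_generated (R : nzRingType) (V : lmodType {poly R})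
    (M : set V) : Prop :=
  exists (I : finType) (x : I -> V),
    (forall i, M (x i)) /\ M `<=` laurent_span x.

(** Freeness is stated coefficientwise: a combination is zero only if each of
    its monomials is, so a generator of order o spans a free module over
    Z/o. Orders are prime powers to make lifting through multiplication by p
    possible. *)
Record laurent_basis (V : lmodType {poly int}) (M : set V) (I : finType)
    (g : I -> V) : Prop := LaurentBasis {
  laurent_basis_in : forall i, M (g i);
  laurent_basis_span : M `<=` laurent_span g;
  laurent_basis_free : forall c : I -> {poly int},
    \sum_i c i *: g i = 0 -> forall i k, g i *~ (c i)`_k = 0;
  laurent_basis_primary : forall i,
    exists q n, prime q /\ g i *+ q ^ n = 0
}.

Section SubmoduleOperations.

Variables (R : comNzRingType) (V : lmodType R) (M : set V).
Hypothesis subM : submodule M.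

Lemma submodule_set0 : submodule [set 0 : V].
Proof. by split=> // a x y -> ->; rewrite scaler0 addr0. Qed.

Lemma submodule_multiples k : submodule (multiples k M).
Proof.
split; first by exists 0; [exact: submodule0|rewrite mul0rn].
move=> a _ _ [x Mx <-] [y My <-]; exists (a *: x + y).
  by case: subM => _; apply.
by rewrite mulrnDl scalerMnr.
Qed.

Lemma submodule_torsion k : submodule (torsion k M).
Proof.
split; first by split; [exact: submodule0|rewrite mul0rn].
move=> a x y [Mx x0] [My y0]; split; first by case: subM => _; apply.
by rewrite mulrnDl scalerMnr x0 y0 scaler0 addr0.
Qed.

End SubmoduleOperations.

Lemma multiples1 (V : zmodType) (M : set V) : multiples 1 M = M.
Proof.
by apply/seteqP; split=> x; [move=> [y My <-]; rewrite mulr1n|exists x].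
Qed.

Lemma multiplesM (V : zmodType) (M : set V) k l :
  multiples l (multiples k M) = multiples (k * l) M.
Proof.
apply/seteqP; split=> z.
  by case=> _ [y My <-] <-; exists y => //; rewrite mulrnA.
by case=> [y My <-]; exists (y *+ k); [exists y|rewrite mulrnA].
Qed.

Section LaurentSpan.

Variables (R : comNzRingType) (V : lmodType {poly R}).

Lemma span_mod0E (I : finType) (x : I -> V) z :
  span_mod [set 0] x z -> exists c, z = \sum_i c i *: x i.
Proof. by move=> [c /eqP]; rewrite subr_eq0 => /eqP; exists c. Qed.

Lemma submodule_laurent_span (I : finType) (x : I -> V) :
  submodule (laurent_span x).
Proof.
have subS := submodule_span (submodule_set0 V) x.
split; first by exists 0; rewrite scaler0; apply: submodule0 subS.
move=> a y z [k yk] [l zl]; exists (k + l)%N; rewrite scalerDr scalerA.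
apply: (submoduleD subS).
  rewrite exprD -mulrA mulrC -scalerA.
  exact: (submoduleZ subS).
by rewrite exprD -scalerA; apply: (submoduleZ subS).
Qed.

Lemma laurent_span_gen (I : finType) (x : I -> V) i : laurent_span x (x i).
Proof.
exists 0; rewrite expr0 scale1r; apply: span_gen; exact: submodule_set0.
Qed.

Lemma laurent_span_shift (I : finType) (x : I -> V) k z :
  laurent_span x ('X^k *: z) -> laurent_span x z.
Proof. by move=> [l]; rewrite scalerA -exprD; exists (l + k)%N. Qed.

Lemma laurent_span_trans (I J : finType) (x : I -> V) (y : J -> V) :
  (forall i, laurent_span y (x i)) -> laurent_span x `<=` laurent_span y.
Proof.
move=> yx z [k /span_mod0E[c zE]]; apply: (@laurent_span_shift _ _ k).
have subS := submodule_laurent_span y.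
rewrite zE; apply: (submodule_sum subS) => i _; exact: (submoduleZ subS).
Qed.

End LaurentSpan.

Lemma scale_poly_expand (V : lmodType {poly int}) (q : {poly int}) (x : V) N :
  (size q <= N)%N -> q *: x = \sum_(k < N) 'X^k *: (x *~ q`_k).
Proof.
move=> le_qN; have {1}-> : q = \poly_(k < N) q`_k.
  apply/polyP => k; rewrite coef_poly; case: ltnP => // le_Nk.
  by rewrite nth_default // (leq_trans le_qN).
rewrite poly_def scaler_suml; apply: eq_bigr => k _.
rewrite -mul_polyC mulrC -scalerA.
have -> : (q`_k)%:P = (q`_k)%:~R by rewrite -(rmorph_int polyC) intz.
by rewrite scaler_int.
Qed.

Lemma scale_killed_coefs (V : lmodType {poly int}) (a : {poly int}) (x : V) :
  (forall k, x *~ a`_k = 0) -> a *: x = 0.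
Proof.
move=> xa0; rewrite (scale_poly_expand _ (leqnn _)) big1 // => k _.
by rewrite xa0 scaler0.
Qed.

Section LiftGenerators.

Variables (V : lmodType {poly int}) (M : set V) (p : nat).
Hypotheses (p_pr : prime p) (subM : submodule M).

(** If e has order a power of p, any preimage d under multiplication by p will
    do, since an integer killing e <> 0 is divisible by p. If e has order
    prime to p, then p is invertible on the multiples of e, and d is chosen
    among them so that it has the same annihilator as e. *)
Lemma primary_lift (e : V) q n :
    prime q -> multiples p M e -> e *+ q ^ n = 0 ->
  exists d, [/\ M d, d *+ p = e, exists r m, prime r /\ d *+ r ^ m = 0 &
    forall z : int, e *~ z = 0 -> d *~ z = 0 \/ (p %| z)%Z].
Proof.
move=> q_pr [x Mx xe] eqn0; have [qp|q_neq_p] := eqVneq q p.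
  have [e0|e_neq0] := eqVneq e 0.
    exists 0; rewrite mul0rn e0; split=> //; first exact: submodule0.
      by exists p, 0; rewrite mul0rn.
    by move=> z _; left; rewrite mul0rz.
  exists x; split=> //; first by exists p, n.+1; rewrite expnS mulrnA xe -qp.
  move=> z ez0; right; apply: contraT => p_ndvd.
  have /coprimezP[[u v] /= uv1] : coprimez (q ^ n)%N z.
    rewrite coprimezE absz_nat coprimeXl //.
    by rewrite qp prime_coprime // -[_ %| _]/(_ %| z)%Z.
  case/eqP: e_neq0; rewrite -[e]mulr1z -uv1 mulrzDr [u * _]mulrC [v * _]mulrC.
  by rewrite !mulrzA ez0 -pmulrn eqn0 !mul0rz addr0.
have /coprimezP[[u v] /= uv1] : coprimez p (q ^ n)%N.
  rewrite coprimezE !absz_nat coprimeXr //.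
  by rewrite prime_coprime // dvdn_prime2 // eq_sym.
have eqnz (k : int) : e *~ (k * (q ^ n)%N) = 0.
  by rewrite [k * _]mulrC mulrzA -pmulrn eqn0 mul0rz.
exists (e *~ u); split.
- rewrite -scaler_int; apply: submoduleZ => //.
  by rewrite -xe; apply: submoduleMn.
- by rewrite pmulrn -mulrzA -[RHS]mulr1z -uv1 mulrzDr eqnz addr0.
- exists q, n; split=> //; rewrite pmulrn -mulrzA; exact: eqnz.
- by move=> z ez0; left; rewrite -mulrzA mulrC mulrzA ez0 mul0rz.
Qed.

End LiftGenerators.

(** Generation: pM is spanned by the p d_i, M[p] by the y_j and pM, and p z is a
    combination of the p d_i, which corrects z to an element of M[p].
    Freeness: in a relation between the d_i and the y_j, multiplication by p and
    freeness of the e_i = p d_i make the d_i part a combination of the e_i,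
    hence an element of pM; then independence of the y_j modulo pM kills the
    other part, and freeness of the e_i applies again. *)
Lemma torsion_step (V : lmodType {poly int}) (M : set V) (p : nat) :
    prime p -> submodule M ->
    laurent_generated (torsion p M) ->
    (forall q x, torsion p M x -> redp p q != 0 ->
       multiples p M (q *: x) -> multiples p M x) ->
    (exists (I : finType) (e : I -> V), laurent_basis (multiples p M) e) ->
  exists (I : finType) (g : I -> V), laurent_basis M g.
Proof.
move=> p_pr subM [J [x [Ux span_x]]] sat [I [e [Me span_e free_e prim_e]]].
have subpM := submodule_multiples subM p.
pose N := torsion p (multiples p M).
have subN : submodule N by apply: submodule_torsion.
have pM_M : multiples p M `<=` M.
  by move=> _ [z Mz <-]; apply: submoduleMn.
have satN q z : torsion p M z -> redp p q != 0 -> N (q *: z) -> N z.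
  by move=> Uz q0 [pMqz _]; split; [exact: sat Uz q0 pMqz|case: Uz].
have [y [Uy span_y ind_y]] := independent_generators p_pr
  (submodule_torsion subM p) subN (fun z => @proj2 _ _) satN Ux.
have /choice[d dP] i := let: ex_intro q (ex_intro n (conj q_pr eqn)) := prim_e i in
  primary_lift p_pr subM q_pr (Me i) eqn.
pose g (k : I + J) := match k with inl i => d i | inr j => y j end.
exists (I + J)%type, g; split.
- by case=> [i|j] /=; [case: (dP i)|case: (Uy j)].
- have subL := submodule_laurent_span g.
  have pML : multiples p M `<=` laurent_span g.
    apply: subset_trans span_e _; apply: laurent_span_trans => i.
    have [_ <- _ _] := dP i; apply: (submoduleMn subL).
    exact: (laurent_span_gen g (inl i)).
  have UL : torsion p M `<=` laurent_span g.
    apply: subset_trans span_x _; apply: laurent_span_trans => j.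
    have [c Nc] := span_y j; rewrite -[x j](subrK (\sum_i c i *: y i)).
    apply: (submoduleD subL); first by apply: pML; case: Nc.
    apply: (submodule_sum subL) => i _; apply: (submoduleZ subL).
    exact: (laurent_span_gen g (inr i)).
  move=> z Mz; have [|k /span_mod0E[c zE]] := span_e (z *+ p); first by exists z.
  apply: (@laurent_span_shift _ _ _ _ k).
  rewrite -['X^k *: z](subrK (\sum_i c i *: d i)); apply: (submoduleD subL).
    apply: UL; split.
      apply: (submoduleB subM); first exact: (submoduleZ subM).
      apply: (submodule_sum subM) => i _; apply: (submoduleZ subM).
      by case: (dP i).
    rewrite mulrnBl scalerMnr zE -sumrMnl -sumrB big1 // => i _.
    by have [_ dE _ _] := dP i; rewrite scalerMnr dE subrr.
  apply: (submodule_sum subL) => i _; apply: (submoduleZ subL).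
  exact: (laurent_span_gen g (inl i)).
- move=> c; rewrite big_sumType /= => c0.
  have e0 : forall i k, e i *~ (c (inl i))`_k = 0.
    apply: (free_e (fun i => c (inl i))); move/(congr1 (fun z => z *+ p)): c0.
    rewrite mul0rn mulrnDl -!sumrMnl [X in _ + X = 0 -> _]big1 ?addr0 => [|j _].
      move=> dp0; rewrite -[RHS]dp0; apply: eq_bigr => i _; have [_ dE _ _] := dP i.
      by rewrite scalerMnr dE.
    by have [_ y0] := Uy j; rewrite scalerMnr y0 scaler0.
  (* The d part, rewritten on the e_i = p d_i. *)
  pose w i := \poly_(k < size (c (inl i)))
    (if (p %| (c (inl i))`_k)%Z then ((c (inl i))`_k %/ p)%Z else 0).
  have wE i k : (w i)`_k =
      if (p %| (c (inl i))`_k)%Z then ((c (inl i))`_k %/ p)%Z else 0.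
    rewrite coef_poly; case: ltnP => // le_k.
    by rewrite [(c (inl i))`_k]nth_default // dvdz0 div0z.
  have dw i : c (inl i) *: d i = w i *: e i.
    have [_ dE _ dp] := dP i.
    apply/eqP; rewrite -dE -scalerMnr -subr_eq0 scalerMnl -scalerBl; apply/eqP.
    apply: scale_killed_coefs => k; rewrite coefB coefMn wE.
    have [p_dvd|p_ndvd] := boolP (p %| (c (inl i))`_k)%Z.
      by rewrite -mulr_natr natz divzK // subrr mulr0z.
    rewrite mul0rn subr0; have [//|] := dp _ (e0 i k).
    by rewrite (negPf p_ndvd).
  have Nc : N (\sum_j c (inr j) *: y j).
    split; last first.
      rewrite -sumrMnl big1 // => j _.
      by have [_ y0] := Uy j; rewrite scalerMnr y0 scaler0.
    have -> : \sum_j c (inr j) *: y j = - \sum_i c (inl i) *: d i.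
      by apply/eqP; rewrite -addr_eq0 addrC c0.
    apply: (submoduleN subpM); apply: (submodule_sum subpM) => i _.
    by rewrite dw; apply: (submoduleZ subpM).
  have yc j k : y j *~ (c (inr j))`_k = 0.
    have [->|cj0] := ind_y _ Nc j; first by rewrite mul0rz.
    have [b ->] := redp_eq0 p_pr cj0.
    rewrite coefMn -mulr_natr natz mulrC mulrzA -pmulrn.
    by have [_ ->] := Uy j; rewrite mul0rz.
  have w0 : forall i k, e i *~ (w i)`_k = 0.
    apply: free_e; rewrite -[RHS]c0 [X in _ = _ + X]big1 ?addr0 => [|j _].
      by apply: eq_bigr => i _; rewrite dw.
    exact: scale_killed_coefs.
  case=> [i|j] k /=; last exact: yc.
  have [_ dE _ dp] := dP i.
  have [//|p_dvd] := dp _ (e0 i k).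
  rewrite -(divzK p_dvd) mulrC mulrzA -pmulrn dE.
  by have := w0 i k; rewrite wE p_dvd.
- case=> [i|j] /=; first by have [_ _ prim_d _] := dP i.
  by exists p, 1; split=> //; have [_ y0] := Uy j; rewrite expn1.
Qed.

Theorem laurent_basis_exists (V : lmodType {poly int}) (M : set V) (n : nat) :
    (0 < n)%N -> submodule M -> (forall x, M x -> x *+ n = 0) ->
    (forall k p, prime p -> laurent_generated (torsion p (multiples k M))) ->
    (forall k p q x, prime p -> torsion p (multiples k M) x ->
       redp p q != 0 -> multiples (k * p) M (q *: x) ->
       multiples (k * p) M x) ->
  exists (I : finType) (g : I -> V), laurent_basis M g.
Proof.
have [m] := ubnP n; elim: m n M => // m IHm n M lt_n n_gt0 subM nM fg sat.
have [n1|n_neq1] := eqVneq n 1%N.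
  have M0 x : M x -> x = 0 by move=> /nM; rewrite n1 mulr1n.
  exists void, (of_void V); split; [by case| |by move=> ? ? []|by case].
  by move=> x /M0 ->; apply: submodule0; apply: submodule_laurent_span.
have n_gt1 : (1 < n)%N by rewrite ltn_neqAle eq_sym n_neq1.
pose p := pdiv n; have p_pr : prime p := pdiv_prime n_gt1.
have nE : (p * (n %/ p) = n)%N by rewrite mulnC divnK ?pdiv_dvd.
apply: (@torsion_step _ _ p) => //.
- by rewrite -[M]multiples1; apply: fg.
- move=> q x Ux q0; have := sat 1 p q x p_pr; rewrite multiples1 mul1n.
  exact.
apply: (IHm (n %/ p)%N).
- by rewrite -ltnS (leq_trans _ lt_n) // ltnS ltn_Pdiv // prime_gt1.
- by rewrite divn_gt0 ?prime_gt0 // dvdn_leq // pdiv_dvd.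
- exact: submodule_multiples.
- by move=> _ [x Mx <-]; rewrite -mulrnA nE nM.
- by move=> k r r_pr; rewrite multiplesM; apply: fg.
- by move=> k r q x r_pr; rewrite !multiplesM mulnA; apply: sat.
Qed.

(** * Bi-infinite sequences as a module over integer polynomials *)

(** A copy of the type of sequences that carries the action of integer
    polynomials, distinct from the pointwise module structures on functions. *)
Definition biseqs (H : zmodType) : Type := int -> H.

HB.instance Definition _ (H : zmodType) := GRing.Zmodule.on (biseqs H).

Section PolyAction.

Variable H : zmodType.
Implicit Types (a b : {poly int}) (x y : biseqs H).

Lemma biseqsD x y i : (x + y) i = x i + y i. Proof. by []. Qed.

Lemma biseqsB x y i : (x - y) i = x i - y i. Proof. by []. Qed.

Definition poly_act a x : biseqs H :=
  fun i => \sum_(k < size a) x (i - k%:Z) *~ a`_k.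

Lemma poly_actE n a x i : (size a <= n)%N ->
  poly_act a x i = \sum_(k < n) x (i - k%:Z) *~ a`_k.
Proof.
move=> le_an; rewrite /poly_act (big_ord_widen n (fun k => x (i - k%:Z) *~ a`_k)) //.
rewrite big_mkcond /=; apply: eq_bigr => k _.
by case: ltnP => // le_ak; rewrite nth_default ?mulr0z.
Qed.

Lemma poly_actDl x : {morph poly_act^~ x : a b / a + b}.
Proof.
move=> a b; apply/funext => i.
pose n := maxn (size a) (size b).
rewrite [LHS](@poly_actE n) ?size_polyD // biseqsD.
rewrite (@poly_actE n a) ?leq_maxl // (@poly_actE n b) ?leq_maxr //.
by rewrite -big_split; apply: eq_bigr => k _; rewrite coefD mulrzDr.
Qed.

Lemma poly_actDr a : {morph poly_act a : x y / x + y}.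
Proof.
move=> x y; apply/funext => i; rewrite biseqsD -big_split.
by apply: eq_bigr => k _; rewrite /= biseqsD mulrzDl.
Qed.

Lemma poly_actC c x : poly_act c%:P x = fun i => x i *~ c.
Proof.
apply/funext => i; rewrite (@poly_actE 1) ?size_polyC_leq1 // big_ord1.
by rewrite coefC subr0.
Qed.

Lemma poly_actMX a x : poly_act (a * 'X) x = fun i => poly_act a x (i - 1).
Proof.
apply/funext => i; rewrite (@poly_actE (size a).+1) ?size_polyMleq //; last first.
  by rewrite (leq_trans (size_polyMleq _ _)) // size_polyX addn2.
rewrite big_ord_recl coefMX eqxx mulr0z add0r; apply: eq_bigr => k _.
by rewrite coefMX /= -addrA -opprD -PoszD.
Qed.

Lemma poly_actA a b x : poly_act a (poly_act b x) = poly_act (a * b) x.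
Proof.
elim/poly_ind: a => [|a c IHa].
  rewrite mul0r; apply/funext => i.
  by rewrite !(@poly_actE 0) ?size_poly0 // !big_ord0.
rewrite mulrDl !poly_actDl mulrAC !poly_actMX IHa; congr (_ + _).
rewrite mul_polyC poly_actC; apply/funext => i.
rewrite (@poly_actE (size b) (c *: b)) ?size_scale_leq // mulrz_suml.
by apply: eq_bigr => k _; rewrite coefZ mulrC mulrzA.
Qed.

Lemma poly_act1 x : poly_act 1 x = x.
Proof. by rewrite poly_actC; apply/funext => i; rewrite mulr1z. Qed.

End PolyAction.

HB.instance Definition _ (H : zmodType) :=
  GRing.Zmodule_isLmodule.Build {poly int} (biseqs H)
    (@poly_actA H) (@poly_act1 H) (@poly_actDr H) (@poly_actDl H).

Section BiseqsTheory.

Variable H : zmodType.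
Implicit Types (x y : biseqs H).

Lemma biseqsMn x k i : (x *+ k) i = x i *+ k.
Proof. by elim: k => // k IHk; rewrite !mulrS biseqsD IHk. Qed.

Lemma biseqs_sum (I : Type) (r : seq I) (P : pred I) (x : I -> biseqs H) i :
  (\sum_(k <- r | P k) x k) i = \sum_(k <- r | P k) x k i.
Proof. exact: (big_morph (fun y : biseqs H => y i)). Qed.

Lemma biseqsXn k x i : ('X^k *: x) i = x (i - k%:Z).
Proof.
elim: k i => [|k IHk] i; first by rewrite expr0 scale1r subr0.
rewrite exprSr [LHS](congr1 (@^~ i) (poly_actMX _ _)).
by rewrite [LHS]IHk -addrA -opprD addrC -PoszD.
Qed.

Definition supported (a b : int) x : Prop :=
  forall i, ~~ (a <= i <= b) -> x i = 0.

Lemma scale_supported_left (q : {poly int}) (a : int) x :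
  (forall i, i < a -> x i = 0) -> forall i, i < a -> (q *: x) i = 0.
Proof.
move=> x0 i lt_ia; rewrite [LHS]/(poly_act q x i) /poly_act big1 // => k _.
by rewrite x0 ?mul0rz //; lia.
Qed.

Definition bshiftz (t : int) x : biseqs H := fun i => x (i + t).

Definition cutoff (t : int) x : biseqs H := fun i => if i <= t then x i else 0.

End BiseqsTheory.

(** * Order control of finitely supported sequences *)

(** The field oc_control is order controllability with orders expressed
    through the multiples that vanish, the form in which it passes to
    multiples and torsion. *)
Record order_controlled (H : zmodType) (n : nat) (M : set (biseqs H)) : Prop :=
  OrderControlled {
    oc_submodule : submodule M;
    oc_unshift : forall x, M ('X *: x) -> M x;
    oc_finite : forall x, M x -> exists a b, supported a b x;
    oc_control : forall x, M x -> exists y, [/\ M y,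
      forall i, i <= 0 -> y i = x i, forall i, n%:Z < i -> y i = 0 &
      forall m, (forall i, 0 < i <= n%:Z -> x i *+ m = 0) ->
        forall i, 0 < i <= n%:Z -> y i *+ m = 0]
  }.

Section OrderControl.

Variables (H : zmodType) (n : nat).
Implicit Types (M : set (biseqs H)) (x y : biseqs H).

Lemma oc_unshiftn M : order_controlled n M ->
  forall k x, M ('X^k *: x) -> M x.
Proof.
move=> ocM; elim=> [|k IHk] x; first by rewrite expr0 scale1r.
by rewrite exprS -scalerA => /(oc_unshift ocM)/IHk.
Qed.

Lemma bshiftz_Xn (k : nat) x : 'X^k *: bshiftz k%:Z x = x.
Proof. by apply/funext => i; rewrite biseqsXn /bshiftz subrK. Qed.

Lemma Xn_bshiftz (k : nat) x : bshiftz (- k%:Z) x = 'X^k *: x.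
Proof. by apply/funext => i; rewrite biseqsXn. Qed.

Lemma oc_bshiftz M : order_controlled n M ->
  forall t x, M x -> M (bshiftz t x).
Proof.
move=> ocM [k|k] x Mx; first by apply: (oc_unshiftn ocM (k := k)); rewrite bshiftz_Xn.
rewrite NegzE Xn_bshiftz; exact: (submoduleZ (oc_submodule ocM)).
Qed.

Lemma bshiftzA t u x : bshiftz t (bshiftz u x) = bshiftz (t + u) x.
Proof. by apply/funext => i; rewrite /bshiftz addrA. Qed.

Lemma bshiftz0 x : bshiftz 0 x = x.
Proof. by apply/funext => i; rewrite /bshiftz addr0. Qed.

Lemma oc_control_at M (t : int) x : order_controlled n M -> M x ->
  exists y, [/\ M y, forall i, i <= t -> y i = x i &
    forall i, t + n%:Z < i -> y i = 0].
Proof.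
move=> ocM Mx; have [y [My yx y0 _]] := oc_control ocM (oc_bshiftz ocM t Mx).
exists (bshiftz (- t) y); split; first exact: (oc_bshiftz ocM).
  by move=> i le_it; rewrite /bshiftz yx ?subr_le0 // /bshiftz subrK.
by move=> i lt_i; rewrite /bshiftz y0 // ltrBrDl.
Qed.

(** The restriction of x to the window has order 1, hence so does that of the
    controlled sequence, which is therefore exactly the past of x. *)
Lemma oc_cutoff M (t : int) x : order_controlled n M -> M x ->
  (forall i, t < i <= t + n%:Z -> x i = 0) -> M (cutoff t x).
Proof.
move=> ocM Mx x0.
have [y [My yx y0 ym]] := oc_control ocM (oc_bshiftz ocM t Mx).
have -> : cutoff t x = bshiftz (- t) y; last exact: (oc_bshiftz ocM).
apply/funext => i; rewrite /cutoff /bshiftz; case: ifPn => [le_it|].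
  by rewrite yx ?subr_le0 // /bshiftz subrK.
rewrite -ltNge => lt_ti; have [le_n|lt_n] := lerP (i - t) n%:Z; last first.
  by rewrite y0.
rewrite -[y _]mulr1n ym //; last by rewrite subr_gt0 lt_ti.
by move=> j lt_j; rewrite mulr1n /bshiftz x0 //; lia.
Qed.

Lemma oc_multiples M k :
  order_controlled n M -> order_controlled n (multiples k M).
Proof.
move=> ocM; split.
- exact: submodule_multiples (oc_submodule ocM) k.
- move=> x [y My yx]; exists (bshiftz 1 y); first exact: (oc_bshiftz ocM).
  apply/funext => i; rewrite biseqsMn /bshiftz -biseqsMn yx.
  by rewrite -['X]expr1 biseqsXn addrK.
- move=> _ [y My <-]; have [a [b yab]] := oc_finite ocM My.
  by exists a, b => i /yab; rewrite biseqsMn => ->; rewrite mul0rn.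
- move=> _ [x Mx <-]; have [y [My yx y0 ym]] := oc_control ocM Mx.
  exists (y *+ k); split.
  + by exists y.
  + by move=> i /yx; rewrite !biseqsMn => ->.
  + by move=> i /y0; rewrite !biseqsMn => ->; rewrite mul0rn.
  + move=> m xm i i_n; rewrite biseqsMn -mulrnA; apply: ym => // j /xm.
    by rewrite biseqsMn -mulrnA.
Qed.

(** The controlled sequence is again killed by p: before the window it agrees
    with x, on the window the order condition applies, after it it is 0. *)
Lemma oc_torsion M p :
  order_controlled n M -> order_controlled n (torsion p M).
Proof.
move=> ocM; split.
- exact: submodule_torsion (oc_submodule ocM) _.
- move=> x [MXx Xxp]; split; first exact: (oc_unshift ocM).
  apply/funext => i; rewrite biseqsMn.
  have -> : x i = ('X *: x) (i + 1) by rewrite -['X]expr1 biseqsXn addrK.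
  by rewrite -biseqsMn Xxp.
- by move=> x [/(oc_finite ocM)].
- move=> x [Mx xp]; have [y [My yx y0 ym]] := oc_control ocM Mx.
  exists y; split=> //; split=> //; apply/funext => i; rewrite biseqsMn.
  have x0 j : x j *+ p = 0 by rewrite -biseqsMn xp.
  have [/yx ->|lt0i] := lerP i 0; first exact: x0.
  have [le_in|/y0 ->] := lerP i n%:Z; last by rewrite mul0rn.
  by apply: ym => [j _|]; [exact: x0|rewrite lt0i].
Qed.

(** Every word of M is a sum of shifted words of M of width at most n: control
    at the left end splits off such a word and shortens the rest, without
    leaving the interval that supports the word. *)
Lemma control_ind M (Q : int -> int -> biseqs H -> Prop) :
    order_controlled n M ->
    (forall a b x, M x -> supported a b x -> b <= a + n%:Z -> Q a b x) ->
    (forall a b x y, a + n%:Z < b -> Q a (a + n%:Z) x -> Q (a + 1) b y ->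
       Q a b (x + y)) ->
  forall a b x, M x -> supported a b x -> Q a b x.
Proof.
move=> ocM Qbase Qstep a b x Mx.
have [l] := ubnP `|b - a|%N; elim: l a x Mx => // l IHl a x Mx lt_l xab.
have [le_b|lt_b] := lerP b (a + n%:Z); first exact: Qbase.
have [y [My yx y0]] := oc_control_at a ocM Mx.
have yab : supported a (a + n%:Z) y.
  move=> i; have [le_ia|lt_ai] := lerP i a; last by move=> ?; apply: y0; lia.
  by move=> i_a; rewrite yx // xab //; lia.
rewrite -[x](subrK y) addrC; apply: Qstep => //; first by apply: Qbase.
apply: IHl.
- exact: (submoduleB (oc_submodule ocM)).
- by lia.
- move=> i i_ab; rewrite biseqsB; have [le_ia|lt_ai] := lerP i a.
    by rewrite yx // subrr.
  by rewrite xab ?y0 ?subrr //; lia.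
Qed.

(** Modulo p, a nonzero q is X^v times a polynomial with nonzero constant term,
    hence a unit multiple of X^v (1 - w) with w divisible by X. Multiplying by
    1 + w + ... + w^(l-1) puts x - w^l x in M, where w^l x lives at least l
    steps to the right of the left end of x; for l large the two terms are
    separated by a gap of length n and x is cut off. *)
Lemma oc_saturated M p q x : prime p -> order_controlled n M ->
    (exists a b, supported a b x) -> x *+ p = 0 -> redp p q != 0 ->
  M (q *: x) -> M x.
Proof.
move=> p_pr ocM [a [b xab]] xp q0 Mqx.
have subM := oc_submodule ocM.
have [v [r r0 qE]] := multiplicity_XsubC (redp p q) 0.
rewrite q0 /= in r0.
have /factor_theorem[e eE] : root (1 - (r.[0])^-1 *: r) 0.
  by rewrite rootE !hornerE mulVf ?subrr.
(* f lifts e, so that w = f X; u lifts the inverse of the constant term. *)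
have [f fE] := redp_surj e; have [u uE] := redp_surj (r.[0]^-1)%:P.
have M1 : M ((1 - f * 'X) *: x).
  apply: (oc_unshiftn ocM (k := v)); rewrite scalerA.
  suff -> : ('X^v * (1 - f * 'X)) *: x = (u * q) *: x.
    by rewrite -scalerA; apply: (submoduleZ subM).
  apply: (redpZ p_pr) => //; rewrite /redp !rmorphM rmorphB rmorphM /= rmorph1.
  rewrite map_polyXn map_polyX -!/(redp _ _) fE uE qE.
  rewrite -[X in _ - X](_ : 1 - r.[0]^-1 *: r = _); last by rewrite eE subr0.
  by rewrite opprB addrC subrK subr0 mulrC mul_polyC scalerAl.
pose l := `|b - a|%N.+1 + n; pose w := f * 'X.
have Mw : M (x - w ^+ l *: x).
  rewrite -[X in X - _]scale1r -scalerBl -opprB scaleNr; apply: (submoduleN subM).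
  rewrite subrX1 mulrC -scalerA; apply: (submoduleZ subM).
  by rewrite -opprB scaleNr; apply: (submoduleN subM).
have w0 i : i < a + l%:Z -> (w ^+ l *: x) i = 0.
  move=> lt_i; rewrite exprMn mulrC -scalerA biseqsXn.
  apply: (@scale_supported_left _ _ a) => [j lt_j|]; last by lia.
  by rewrite xab //; lia.
have [le_ab|lt_ba] := lerP a b; last first.
  have -> : x = 0; last exact: submodule0.
  by apply/funext => i; rewrite xab //; lia.
have -> : x = cutoff b (x - w ^+ l *: x); last first.
  by apply: (oc_cutoff ocM) => // i i_b; rewrite biseqsB w0 ?xab ?subrr //; lia.
apply/funext => i; rewrite /cutoff; case: ifPn => i_b.
  by rewrite biseqsB w0 ?subr0 //; lia.
by rewrite xab //; lia.
Qed.

End OrderControl.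

Section FiniteAlphabet.

Variables (H : finZmodType) (n : nat) (M : set (biseqs H)).
Hypothesis ocM : order_controlled n M.

Definition block (m : nat) (w : 'rV[H]_m) : biseqs H :=
  fun i => \sum_(d < m | d%:Z == i) w ord0 d.

Lemma block_ord m (w : 'rV[H]_m) (d : 'I_m) : block w d%:Z = w ord0 d.
Proof. by rewrite /block (big_pred1 d) // => e; rewrite eqz_nat. Qed.

Lemma block_outside m (w : 'rV[H]_m) i :
  ~~ (0 <= i < m%:Z) -> block w i = 0.
Proof.
move=> i_m; rewrite /block big1 // => d /eqP di.
by move: i_m (ltn_ord d); rewrite -di; lia.
Qed.

Lemma block_restrict m x : supported 0 m%:Z x ->
  block (\row_(d < m.+1) x d%:Z) = x.
Proof.
move=> x0; apply/funext => i; have [i_m|i_m] := boolP (0 <= i <= m%:Z).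
  have lt_im : (`|i| < m.+1)%N by lia.
  have -> : i = (Ordinal lt_im)%:Z by rewrite /=; lia.
  by rewrite block_ord mxE.
by rewrite x0 // block_outside //; lia.
Qed.

(** The generators are all the words of M supported in [0, n], of which there
    are finitely many. *)
Lemma oc_laurent_generated : laurent_generated M.
Proof.
pose g (w : 'rV[H]_n.+1) : biseqs H :=
  if `[< M (block w) >] then block w else 0.
exists 'rV[H]_n.+1, g; split.
  move=> w; rewrite /g; case: asboolP => // _.
  exact: submodule0 (oc_submodule ocM).
have subL := submodule_laurent_span g.
move=> x Mx; have [a [b xab]] := oc_finite ocM Mx.
apply: (control_ind (Q := fun _ _ => laurent_span g) ocM _ _ Mx xab).
  move=> {x Mx a b xab} a b x Mx xab le_b; pose y := bshiftz a x.
  have xy : x = bshiftz (- a) y by rewrite /y bshiftzA addNr bshiftz0.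
  have Ly : laurent_span g y.
    have My : M y by apply: (oc_bshiftz ocM).
    have yE : block (\row_(d < n.+1) y d%:Z) = y.
      by apply: block_restrict => i i_n; rewrite /y /bshiftz xab //; lia.
    have -> : y = g (\row_(d < n.+1) y d%:Z).
      by rewrite /g yE; case: asboolP.
    exact: laurent_span_gen.
  rewrite xy; case: (a) => k; rewrite ?NegzE ?opprK ?Xn_bshiftz.
    exact: (submoduleZ subL).
  by apply: (@laurent_span_shift _ _ _ _ k.+1); rewrite bshiftz_Xn.
by move=> _ _ y z _ Ly Lz; apply: (submoduleD subL).
Qed.

End FiniteAlphabet.

Lemma finZmod_exponent (H : finZmodType) (x : biseqs H) : x *+ #|H| = 0.
Proof.
apply/funext => i; rewrite biseqsMn -FinRing.zmodXgE.
by rewrite -cardsT expg_cardG ?inE.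
Qed.

Theorem oc_laurent_basis (H : finZmodType) (n : nat) (M : set (biseqs H)) :
    order_controlled n M ->
  exists (I : finType) (g : I -> biseqs H), laurent_basis M g.
Proof.
move=> ocM; apply: (@laurent_basis_exists _ _ #|H|).
- by apply/card_gt0P; exists 0.
- exact: oc_submodule ocM.
- by move=> x _; apply: finZmod_exponent.
- move=> k p p_pr; apply: oc_laurent_generated.
  by apply: oc_torsion; apply: oc_multiples ocM.
- move=> k p q x p_pr [Mx xp] q0; apply: (oc_saturated p_pr _ _ xp q0).
    exact: oc_multiples ocM.
  exact: oc_finite (oc_multiples k ocM) _ Mx.
Qed.

(** * The coding alphabet *)

(** The group generated by a finite family. Applied to the words of a basis it
    is the alphabet K of the encoder; as a subgroup of the row vectors it is
    isomorphic to the product of the Z/o_i. *)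
Definition int_span (W : zmodType) (I : finType) (g : I -> W) : {pred W} :=
  fun w => `[< exists c : I -> int, w = \sum_i g i *~ c i >].

Lemma int_span_zmod_closed (W : zmodType) (I : finType) (g : I -> W) :
  zmod_closed (int_span g).
Proof.
split; first by apply/asboolP; exists (fun=> 0); rewrite big1 // => i; rewrite mulr0z.
move=> _ _ /asboolP[c ->] /asboolP[d ->]; apply/asboolP.
exists (fun i => c i - d i); rewrite -sumrB.
by apply: eq_bigr => i _; rewrite mulrzBr.
Qed.

HB.instance Definition _ (W : zmodType) (I : finType) (g : I -> W) :=
  GRing.isZmodClosed.Build W (int_span g) (int_span_zmod_closed g).

Definition int_span_type (W : finZmodType) (I : finType) (g : I -> W) : Type :=
  {w : W | w \in int_span g}.

Section IntSpanType.
Variables (W : finZmodType) (I : finType) (g : I -> W).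
HB.instance Definition _ := SubType.on (int_span_type g).
HB.instance Definition _ := [Finite of int_span_type g by <:].
HB.instance Definition _ := [SubChoice_isSubZmodule of int_span_type g by <:].
End IntSpanType.

Section Encoding.

Variables (K H : finZmodType) (m : nat) (f : {additive K -> 'rV[H]_m}).

Lemma block_zmod_morphism : zmod_morphism (@block H m).
Proof.
move=> v w; apply/funext => i; rewrite biseqsB /block -sumrB.
by apply: eq_bigr => d _; rewrite !mxE.
Qed.

HB.instance Definition _ :=
  GRing.isZmodMorphism.Build 'rV[H]_m (biseqs H) (@block H m)
    block_zmod_morphism.

Lemma block_inj (w : 'rV[H]_m) : block w = 0 -> w = 0.
Proof. by move=> w0; apply/rowP => d; rewrite -block_ord w0 mxE. Qed.

(** The sum over k of the word f (u k) placed at position k, evaluated at i: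
    only the m words that start in the interval from i - m + 1 to i matter. *)
Definition encode (u : biseqs K) : biseqs H :=
  fun i => \sum_(d < m) f (u (i - d%:Z)) ord0 d.

Lemma encode_bshiftz t u : encode (bshiftz t u) = bshiftz t (encode u).
Proof.
by apply/funext => i; apply: eq_bigr => d _; rewrite /bshiftz addrAC.
Qed.

Lemma encode_zmod_morphism : zmod_morphism encode.
Proof.
move=> u v; apply/funext => i; rewrite biseqsB -sumrB.
by apply: eq_bigr => d _; rewrite biseqsB raddfB !mxE.
Qed.

HB.instance Definition _ :=
  GRing.isZmodMorphism.Build (biseqs K) (biseqs H) encode encode_zmod_morphism.

Lemma encode_blocks (L : nat) (u : biseqs K) : supported 0 L%:Z u ->
  encode u = \sum_(k < L.+1) 'X^k *: block (f (u k%:Z)).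
Proof.
move=> uL; apply/funext => i; rewrite biseqs_sum.
under eq_bigr => k _ do rewrite biseqsXn /block big_mkcond /=.
rewrite exchange_big /=; apply: eq_bigr => d _; rewrite -big_mkcond /=.
have [i_L|i_L] := boolP (0 <= i - d%:Z <= L%:Z); last first.
  rewrite uL // raddf0 mxE big_pred0 // => k; have := ltn_ord k.
  by move: i_L; lia.
have lt_L : (`|i - d%:Z| < L.+1)%N by lia.
have iE : i - d%:Z = (Ordinal lt_L)%:Z by rewrite /=; lia.
rewrite (big_pred1 (Ordinal lt_L)) => [|k]; first by rewrite -iE.
by rewrite /= -[RHS]val_eqE /=; lia.
Qed.

End Encoding.

Lemma laurent_basis_shift (V : lmodType {poly int}) (M : set V) (I : finType)
    (g : I -> V) (k : nat) :
  submodule M -> laurent_basis M g -> laurent_basis M (fun i => 'X^k *: g i).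
Proof.
move=> subM [gM gspan gfree gprim]; split.
- by move=> i; apply: (submoduleZ subM).
- apply: subset_trans gspan _; apply: laurent_span_trans => i.
  apply: (@laurent_span_shift _ _ _ _ k).
  exact: (laurent_span_gen (fun i => 'X^k *: g i)).
- move=> c c0 i j; have := gfree (fun i => c i * 'X^k) _ i (j + k)%N.
  rewrite coefMXn ltnNge leq_addl /= addnK => gc.
  rewrite -scaler_int scalerA mulrC -scalerA scaler_int gc ?scaler0 //.
  by rewrite -[RHS]c0; apply: eq_bigr => e _; rewrite scalerA.
- move=> i; have [q [n [q_pr gn]]] := gprim i; exists q, n; split=> //.
  by rewrite scalerMnr gn scaler0.
Qed.

(** On finitely supported sequences, the encoder is a bijection onto M. *)
Record code_coordinates (K H : finZmodType) (m : nat)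
    (f : {additive K -> 'rV[H]_m}) (M : set (biseqs H)) : Prop :=
  CodeCoordinates {
    code_in : forall a b u, supported a b u -> M (encode f u);
    code_onto : forall x, M x -> exists a b u, supported a b u /\ encode f u = x;
    code_inj : forall a b u, supported a b u -> encode f u = 0 -> u = 0
  }.

Section CodeFromBasis.

Variables (H : finZmodType) (n m : nat) (M : set (biseqs H)).
Hypothesis ocM : order_controlled n M.
Variables (I : finType) (w : I -> 'rV[H]_m).
Hypothesis basis_w : laurent_basis M (fun i => block (w i)).

Let K : finZmodType := int_span_type w.
Let f : {additive K -> 'rV[H]_m} := \val.

Lemma encode_combination (L : nat) (u : biseqs K) (c : I -> {poly int}) :
    supported 0 L%:Z u -> (forall i, size (c i) <= L.+1)%N ->
    (forall k, (k <= L)%N -> f (u k%:Z) = \sum_i w i *~ (c i)`_k) ->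
  encode f u = \sum_i c i *: block (w i).
Proof.
move=> uL cL uc; rewrite (encode_blocks f uL).
under [RHS]eq_bigr => i _ do rewrite (scale_poly_expand _ (cL i)).
rewrite exchange_big; apply: eq_bigr => k _.
rewrite uc; last by rewrite -ltnS.
rewrite -scaler_sumr raddf_sum; congr (_ *: _).
by apply: eq_bigr => i _; rewrite raddfMz.
Qed.

(** Each letter of u is an integer combination of the words w i. Once u is moved
    to nonnegative positions, the coefficients at a given w i, read along u,
    form a polynomial. *)
Lemma encode_span (a b : int) (u : biseqs K) : supported a b u ->
  exists (L : nat) (c : I -> {poly int}),
    [/\ supported 0 L%:Z (bshiftz a u),
     encode f (bshiftz a u) = \sum_i c i *: block (w i) &
     forall k, (k <= L)%N -> f (u (k%:Z + a)) = \sum_i w i *~ (c i)`_k].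
Proof.
move=> uab; pose L := `|b - a|%N.
have uL : supported 0 L%:Z (bshiftz a u).
  by move=> i i_L; rewrite /bshiftz uab //; lia.
have /choice[c cP] k : exists c : I -> int, f (u (k%:Z + a)) = \sum_i w i *~ c i.
  by have /asboolP := valP (u (k%:Z + a)).
have cE i k : (k <= L)%N -> (\poly_(k < L.+1) c k i)`_k = c k i.
  by rewrite coef_poly ltnS => ->.
exists L, (fun i => \poly_(k < L.+1) c k i); split=> //.
  apply: (encode_combination uL) => [i|k le_kL]; first exact: size_poly.
  by rewrite [LHS]cP; apply: eq_bigr => i _; rewrite cE.
by move=> k le_kL; rewrite cP; apply: eq_bigr => i _; rewrite cE.
Qed.

Lemma code_coordinates_basis : code_coordinates f M.
Proof.
have subM := oc_submodule ocM; split.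
- move=> a b u /encode_span[L [c [_ uc _]]].
  rewrite -[u]bshiftz0 -(addNr a) -bshiftzA encode_bshiftz.
  apply: (oc_bshiftz ocM); rewrite uc; apply: (submodule_sum subM) => i _.
  by apply: (submoduleZ subM); apply: (laurent_basis_in basis_w).
- move=> x /(laurent_basis_span basis_w)[k /span_mod0E[c xc]].
  pose L := \max_i size (c i).
  have inw j : \sum_i w i *~ (c i)`_j \in int_span w.
    by apply/asboolP; exists (fun i => (c i)`_j).
  pose v j : K := exist (fun z => z \in int_span w) _ (inw j).
  pose u : biseqs K := fun t => if 0 <= t then v `|t|%N else 0.
  have cL i : (size (c i) <= L.+1)%N by rewrite ltnW // ltnS leq_bigmax.
  have uL : supported 0 L%:Z u.
    move=> t t_L; rewrite /u; case: ifP => // t_ge0; apply: val_inj.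
    rewrite [LHS]/= big1 // => i _; rewrite nth_default ?mulr0z //.
    by apply: (@leq_trans L); [exact: leq_bigmax|lia].
  exists (- k%:Z), (L%:Z - k%:Z), (bshiftz k%:Z u); split.
    by move=> t t_L; rewrite /bshiftz uL //; lia.
  rewrite encode_bshiftz (encode_combination uL cL) => [|j _]; last first.
    by [].
  by rewrite -xc -Xn_bshiftz bshiftzA subrr bshiftz0.
- move=> a b u uab u0; have [L [c [uL uc cP]]] := encode_span uab.
  rewrite encode_bshiftz u0 in uc.
  have c0 := laurent_basis_free basis_w (esym uc).
  have {}u0 : bshiftz a u = 0.
    apply/funext => i; have [i_L|/uL //] := boolP (0 <= i <= L%:Z).
    have -> : i = `|i|%:Z by lia.
    apply: val_inj; rewrite [LHS]cP; last by lia.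
    apply: block_inj; rewrite raddf_sum big1 // => e _.
    by rewrite raddfMz; apply: c0.
  by rewrite -[u]bshiftz0 -(addNr a) -bshiftzA u0.
Qed.

End CodeFromBasis.

(** The basis elements are translated to the right by a common amount, so that
    all of them become words starting at position 0. *)
Theorem oc_code (H : finZmodType) (n : nat) (M : set (biseqs H)) :
    order_controlled n M ->
  exists (K : finZmodType) (m : nat) (f : {additive K -> 'rV[H]_m}),
    code_coordinates f M.
Proof.
move=> ocM; have [I [g basis_g]] := oc_laurent_basis ocM.
have /choice[a aP] i : exists a, exists b, supported a b (g i).
  exact: oc_finite ocM _ (laurent_basis_in basis_g i).
have /choice[b gab] i : exists b, supported (a i) b (g i) by [].
pose k := \max_i `|a i|%N; pose m := (k + \max_i `|b i|)%N.
have gE i : block (\row_(d < m.+1) ('X^k *: g i) d%:Z) = 'X^k *: g i.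
  apply: block_restrict => j j_m; rewrite biseqsXn gab //.
  have := leq_bigmax (F := fun i => `|a i|%N) i.
  by have := leq_bigmax (F := fun i => `|b i|%N) i; rewrite -/k; lia.
pose w i := \row_(d < m.+1) ('X^k *: g i) d%:Z.
have basis_w : laurent_basis M (fun i => block (w i)).
  have -> : (fun i => block (w i)) = (fun i => 'X^k *: g i) by apply/funext.
  exact: laurent_basis_shift (oc_submodule ocM) basis_g.
exists (int_span_type w), m.+1, \val.
exact (code_coordinates_basis ocM basis_w).
Qed.

(** * Decoding with a bounded window *)

Section Locality.

Variables (K H : finZmodType) (n m : nat) (f : {additive K -> 'rV[H]_m}).
Variable M : set (biseqs H).
Hypotheses (ocM : order_controlled n M) (cc : code_coordinates f M).

Lemma supportedD (a b a' b' : int) (u v : biseqs K) :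
  supported a b u -> supported a' b' v ->
  supported (Num.min a a') (Num.max b b') (u + v).
Proof.
by move=> uab vab i i_ab; rewrite biseqsD uab ?vab ?addr0 //; lia.
Qed.

Lemma supportedN (a b : int) (u : biseqs K) :
  supported a b u -> supported a b (- u).
Proof. by move=> uab i /uab ui; rewrite -[- u]sub0r biseqsB ui subrr. Qed.

Lemma encode_eq a b a' b' (u v : biseqs K) :
  supported a b u -> supported a' b' v -> encode f u = encode f v -> u = v.
Proof.
move=> uab vab uv; apply/eqP; rewrite -subr_eq0; apply/eqP.
apply: (code_inj cc (supportedD uab (supportedN vab))).
by rewrite raddfB /= uv subrr.
Qed.

(** The coordinates of the finitely many words supported in [0, n] have bounded
    supports, and these words generate M without leaving the support of the
    word to be generated ([control_ind]). *)
Lemma decode_support : exists c : nat, forall a b x, M x -> supported a b x ->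
  exists u, supported (a - c%:Z) (b + c%:Z) u /\ encode f u = x.
Proof.
have /choice[ab abP] (w : 'rV[H]_n.+1) : exists ab : int * int, M (block w) ->
    exists u, supported ab.1 ab.2 u /\ encode f u = block w.
  have [/(code_onto cc)[a [b [u uP]]]|nMw] := pselect (M (block w)).
    by exists (a, b) => _; exists u.
  by exists (0, 0).
pose c := (\max_w `|(ab w).1| + \max_w `|(ab w).2|)%N.
exists c; apply: (control_ind (Q := fun a b x =>
  exists u, supported (a - c%:Z) (b + c%:Z) u /\ encode f u = x) ocM).
- move=> a b x Mx xab le_b; have [le_ab|lt_ba] := lerP a b; last first.
    exists 0; split=> //; rewrite raddf0; apply/funext => i.
    by rewrite xab //; lia.
  have xa : block (\row_(d < n.+1) bshiftz a x d%:Z) = bshiftz a x.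
    by apply: block_restrict => i i_n; rewrite /bshiftz xab //; lia.
  have := abP (\row_(d < n.+1) bshiftz a x d%:Z); rewrite xa.
  case=> [|u [uab ux]]; first exact: (oc_bshiftz ocM).
  exists (bshiftz (- a) u); split; last first.
    by rewrite encode_bshiftz ux bshiftzA addNr bshiftz0.
  move=> i i_c; rewrite /bshiftz uab //.
  set w := \row_(d < n.+1) _ in uab *.
  have := leq_bigmax (F := fun w => `|(ab w).1|%N) w.
  by have := leq_bigmax (F := fun w => `|(ab w).2|%N) w; lia.
- move=> a b x y lt_b [u [uab <-]] [v [vab <-]]; exists (u + v); split.
    by move=> i i_c; rewrite biseqsD uab ?vab ?addr0 //; lia.
  by rewrite raddfD.
Qed.

Lemma encode_supported a b (u : biseqs K) :
  supported a b u -> supported a (b + m%:Z) (encode f u).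
Proof.
move=> uab i i_ab; rewrite /encode big1 // => d _.
by rewrite uab ?raddf0 ?mxE //; have := ltn_ord d; lia.
Qed.

(** A word x = encode f u vanishing on a long window around t splits by
    [oc_cutoff] into a past word and a future word of M; by [decode_support] the
    coordinates of either part vanish at t, and by uniqueness they add up
    to u. *)
Lemma code_local : exists c : nat, forall a b u t, supported a b u ->
  (forall i, t - c%:Z <= i <= t + c%:Z -> encode f u i = 0) -> u t = 0.
Proof.
have [c cP] := decode_support; exists (c + n)%N => a b u t uab.
wlog -> : t u a b uab / t = 0.
  move=> th x0; have -> : u t = bshiftz t u 0 by rewrite /bshiftz add0r.
  apply: (th 0 (bshiftz t u) (a - t) (b - t)) => // [i i_ab|i i_c].
    by rewrite /bshiftz uab //; lia.
  by rewrite encode_bshiftz /bshiftz x0 //; lia.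
move=> x0; pose x := encode f u; have Mx : M x := code_in cc uab.
have xab : supported a (b + m%:Z) x by apply: encode_supported.
have My : M (cutoff 0 x).
  by apply: (oc_cutoff ocM) => // i i_n; apply: x0; lia.
have Mz : M (x - cutoff 0 x) by apply: (submoduleB (oc_submodule ocM)).
have [|v [vab vy]] := cP a (- (c + n)%N%:Z - 1) _ My.
  move=> i i_c; rewrite /cutoff; case: ifP => // i_le0.
  by have [i_a|i_a] := boolP (a <= i <= b + m%:Z); [apply: x0|apply: xab]; lia.
have [|w [wab wz]] := cP ((c + n)%N%:Z + 1) (b + m%:Z) _ Mz.
  move=> i i_c; rewrite biseqsB /cutoff; case: ifP => i_le0; first by rewrite subrr.
  rewrite subr0.
  by have [i_a|i_a] := boolP (a <= i <= b + m%:Z); [apply: x0|apply: xab]; lia.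
have -> : u = v + w.
  apply: (encode_eq uab (supportedD vab wab)).
  by rewrite raddfD /= vy wz addrC subrK.
by rewrite biseqsD vab ?wab ?addr0 //; lia.
Qed.

End Locality.

Lemma finite_suppP (H : finZmodType) (x : int -> H) :
  finite_set (supp x) <-> exists a b, supported a b (x : biseqs H).
Proof.
split=> [|[a [b xab]]].
  move=> /finite_seqP[s xs]; pose N := \max_(i <- s) `|i|%N.
  exists (- N%:Z), N%:Z => i i_N; apply/eqP/negPn/negP => xi.
  have si : i \in s by have : supp x i by []; rewrite xs.
  have := leq_bigmax_seq (F := fun i : int => `|i|%N) i si isT; rewrite -/N.
  by move: i_N; lia.
pose s := [seq a + k%:Z | k <- iota 0 `|b - a|%N.+1].
apply: (@sub_finite_set _ _ [set` s]); last exact: finite_seq.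
move=> i xi; have i_ab : a <= i <= b by apply: contraNT xi => /xab ->.
suff : i \in s by [].
by apply/mapP; exists `|i - a|%N; rewrite ?mem_iota; lia.
Qed.

Section GroupShift.

Variables (H : finZmodType) (G : set (int -> H)).
Hypothesis hG : group_shift G.

Lemma group_shift0 : G 0.
Proof. by have [/set_mem] := group_shift_subgroup hG. Qed.

Lemma group_shiftB x y : G x -> G y -> G (x - y).
Proof.
have [_ GB] := group_shift_subgroup hG.
by move=> /mem_set Gx /mem_set Gy; apply/set_mem/GB.
Qed.

Lemma group_shiftD x y : G x -> G y -> G (x + y).
Proof.
move=> Gx Gy; rewrite -[y]opprK; apply: group_shiftB => //.
by rewrite -sub0r; apply: group_shiftB => //; apply: group_shift0.
Qed.

Lemma group_shift_bshiftz t x : G x -> G (bshiftz t x).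
Proof.
have Gs y : G y -> G (bshiftz 1 y).
  by move=> Gy; rewrite -(group_shift_invariant hG); exists y.
have Gu y : G (bshiftz 1 y) -> G y.
  rewrite -[in X in X -> _](group_shift_invariant hG) => -[z Gz zy].
  have -> : y = z; last by [].
  apply/funext => i; have /(congr1 (fun u => u (i - 1))) := zy.
  by rewrite /bshift /bshiftz subrK.
move=> Gx; case: t => k.
  elim: k => [|k IHk]; first by rewrite bshiftz0.
  by rewrite -addn1 PoszD addrC -bshiftzA; apply: Gs.
elim: k => [|k IHk]; apply: Gu; rewrite bshiftzA.
  by rewrite NegzE addrN bshiftz0.
have -> : 1 + Negz k.+1 = Negz k by lia.
exact: IHk.
Qed.

Lemma submodule_finite_subcode :
  submodule (finite_subcode G : set (biseqs H)).
Proof.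
have subD x y : finite_subcode G x -> finite_subcode G y -> finite_subcode G (x + y).
  move=> [Gx /finite_suppP[a [b xab]]] [Gy /finite_suppP[a' [b' yab]]].
  split; first exact: group_shiftD.
  by apply/finite_suppP; do 2!eexists; exact: supportedD xab yab.
have sub0 : finite_subcode G 0.
  by split; [exact: group_shift0|apply/finite_suppP; exists 0, 0].
have subN x : finite_subcode G x -> finite_subcode G (- x).
  move=> [Gx /finite_suppP[a [b xab]]]; split.
    by rewrite -sub0r; apply: group_shiftB => //; apply: group_shift0.
  by apply/finite_suppP; exists a, b; apply: supportedN.
have subX k x : finite_subcode G x -> finite_subcode G ('X^k *: (x : biseqs H)).
  move=> [Gx /finite_suppP[a [b xab]]]; rewrite -Xn_bshiftz; split.
    exact: group_shift_bshiftz.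
  apply/finite_suppP; exists (a + k%:Z), (b + k%:Z) => i i_ab.
  by rewrite /bshiftz xab //; lia.
have subMn x k : finite_subcode G x -> finite_subcode G (x *+ k).
  by move=> Gx; elim: k => [|k IHk]; rewrite ?mulrS //; apply: subD.
split=> // q x y Gx Gy; apply: (subD) => //.
rewrite (scale_poly_expand _ (leqnn (size q))).
apply: (big_ind (finite_subcode G : set (biseqs H))) => [|u v|k _];
  [exact: sub0|exact: subD|apply: subX].
by case: (q`_k) => l; rewrite ?NegzE ?mulrNz -pmulrn; [|apply: subN]; apply: subMn.
Qed.

(** Control preserves finiteness of supports, so that it restricts to the
    finite subcode. *)
Lemma order_controllable_subcode : order_controllable G ->
  exists n, order_controlled n (finite_subcode G : set (biseqs H)).
Proof.
move=> [n n_gt0 ctrl]; exists n; split.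
- exact: submodule_finite_subcode.
- move=> x [GXx /finite_suppP[a [b Xxab]]].
  have xE : x = bshiftz 1 ('X *: x).
    by apply/funext => i; rewrite -['X]expr1 /bshiftz biseqsXn addrK.
  split; first by rewrite xE; apply: group_shift_bshiftz.
  apply/finite_suppP; exists (a - 1), (b - 1) => i i_ab.
  by rewrite xE /bshiftz Xxab //; lia.
- by move=> x [_ /finite_suppP].
- move=> x [Gx /finite_suppP[a [b xab]]].
  have [y [Gy yx y0 y_ord]] := ctrl x Gx.
  have {}y0 i : n%:Z < i -> y i = 0.
    by move=> lt_i; apply: contraPP (lt_i) => /eqP/y0 /=; lia.
  have winP (z : int -> H) k : (window n z *+ k = 0) <->
      (forall i, 0 < i <= n%:Z -> z i *+ k = 0).
    split=> [wz i i_n|zk].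
      have lt_i : (`|i|.-1 < n)%N by lia.
      have := congr1 (fun w : 'rV[H]_n => w ord0 (Ordinal lt_i)) wz.
      by rewrite mulmxnE !mxE /=; have -> : `|i|.-1.+1%:Z = i by lia.
    by apply/rowP => d; rewrite mulmxnE !mxE zk //; have := ltn_ord d; lia.
  exists y; split=> //.
    split=> //; apply/finite_suppP; exists (Num.min a 0), n%:Z => i i_a.
    by have [i_le0|i_gt0] := lerP i 0; [rewrite yx // xab //|rewrite y0 //]; lia.
  move=> k /winP xk; apply/winP; rewrite -FinRing.zmodXgE; apply/eqP.
  rewrite -order_dvdn; apply: dvdn_trans y_ord _.
  by rewrite order_dvdn FinRing.zmodXgE; apply/eqP.
Qed.

End GroupShift.

(** * Local maps are continuous *)

Section DiscreteGroup.

Variable K : finZmodType.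

HB.instance Definition _ := GRing.Zmodule.copy (discrete_topology K) K.

Lemma discrete_sub_continuous :
  continuous (fun x : discrete_topology K * discrete_topology K => x.1 - x.2).
Proof.
move=> x A /nbhs_singleton Ax; exists ([set x.1], [set x.2]).
  by split; exact: discrete_set1.
by move=> y /= [-> ->].
Qed.

HB.instance Definition _ :=
  PreTopologicalNmodule_isTopologicalZmodule.Build (discrete_topology K)
    discrete_sub_continuous.

End DiscreteGroup.

Definition agree (K : Type) (a b : int) (x y : int -> K) : Prop :=
  forall i, a <= i <= b -> x i = y i.

Section Cylinders.

Variable K : finZmodType.

Definition cylinder_filter (x : int -> K) : set_system (int -> K) :=
  [set A | exists N : nat, [set y | agree (- N%:Z) N%:Z y x] `<=` A].

Lemma cylinder_filter_filter x : Filter (cylinder_filter x).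
Proof.
split; first by exists 0.
  move=> A B [N NA] [L LB]; exists (N + L)%N => y xy.
  by split; [apply: NA|apply: LB] => i i_N; apply: xy; lia.
by move=> A B AB [N NA]; exists N => y /NA/AB.
Qed.

(** For discrete factors the cylinders on the intervals [-N, N] form a basis of
    neighbourhoods. *)
Lemma nbhs_cylinder (x : biseq K) (A : set (biseq K)) :
  nbhs x A <-> exists N : nat, [set y | agree (- N%:Z) N%:Z y x] `<=` A.
Proof.
split=> [|[N NA]].
  suff : cylinder_filter x --> x by apply.
  have FF := cylinder_filter_filter x.
  apply/cvg_sup => i U [V] [[W] oW <-] WfN WU.
  apply: (filterS WU); exists `|i|%N => y xy.
  by rewrite /= xy //; lia.
have nbhsF : Filter (nbhs x) by exact: nbhs_filter.
suff cyl : nbhs x [set y : biseq K | agree (- N%:Z) N%:Z y x].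
  exact: filterS NA cyl.
move: {A NA} N => N.
have near_at i : nbhs x [set y : biseq K | y i = x i].
  apply: (@proj_continuous _ (fun=> discrete_topology K) i x [set x i]).
  exact: discrete_set1.
elim: N => [|N IHN].
  apply: filterS (near_at 0) => y xy i i_0.
  by have -> : i = 0 by lia.
have near_ends :=
  @filterI _ _ nbhsF _ _ (near_at N.+1%:Z) (near_at (- N.+1%:Z)).
apply: (@filterS _ _ nbhsF _ _ _ (@filterI _ _ nbhsF _ _ IHN near_ends)) => y [xy [xyN xyN']] i i_N.
have [->//|iN] := eqVneq i N.+1%:Z; have [->//|iN'] := eqVneq i (- N.+1%:Z).
by apply: xy; lia.
Qed.

End Cylinders.

Lemma local_continuous_within (K H : finZmodType) (A : set (int -> K)) (c : nat)
    (F : (int -> K) -> (int -> H)) :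
    (forall x y i, A x -> A y -> agree (i - c%:Z) (i + c%:Z) x y ->
       F x i = F y i) ->
  {within (A : set (biseq K)), continuous (F : biseq K -> biseq H)}.
Proof.
move=> Floc; apply/subspace_continuousP => x Ax B /nbhs_cylinder[N NB].
apply/(@nbhs_cylinder K x); exists (N + c)%N => y xy Ay; apply: NB => i i_N.
by apply: Floc => // j j_i; apply: xy; lia.
Qed.

Lemma local_continuous (K H : finZmodType) (c : nat)
    (F : (int -> K) -> (int -> H)) :
    (forall x y i, agree (i - c%:Z) (i + c%:Z) x y -> F x i = F y i) ->
  continuous (F : biseq K -> biseq H).
Proof.
move=> Floc x B /nbhs_cylinder[N NB].
apply/(@nbhs_cylinder K x); exists (N + c)%N => y xy; apply: NB => i i_N.
by apply: Floc => // j j_i; apply: xy; lia.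
Qed.

(** * The conjugacy *)

Section Conjugacy.

Variables (K H : finZmodType) (G : set (int -> H)) (n m : nat).
Variable f : {additive K -> 'rV[H]_m}.
Hypotheses (hG : group_shift G) (hoc : order_controllable G).
Let M : set (biseqs H) := finite_subcode G.
Hypotheses (ocM : order_controlled n M) (cc : code_coordinates f M).

Lemma closed_cylinder x :
  (forall N : nat, exists y, G y /\ agree (- N%:Z) N%:Z y x) -> G x.
Proof.
move=> Gx; apply: (group_shift_closed hG) => B /nbhs_cylinder[N NB].
by have [y [Gy xy]] := Gx N; exists y; split=> //; apply: NB.
Qed.

Lemma encode_local (u v : int -> K) i :
  agree (i - m%:Z) (i + m%:Z) u v -> encode f u i = encode f v i.
Proof.
move=> uv; apply: eq_bigr => d _; rewrite uv //.
by have := ltn_ord d; lia.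
Qed.

Definition truncate (a b : int) (u : int -> K) : int -> K :=
  fun i => if a <= i <= b then u i else 0.

Lemma truncate_supported a b u : supported a b (truncate a b u).
Proof. by move=> i /negPf i_ab; rewrite /truncate i_ab. Qed.

(** The truncations of u are encoded in the finite subcode and approximate the
    image of u on larger and larger intervals; G is closed. *)
Lemma encode_in u : G (encode f u).
Proof.
apply: closed_cylinder => N; pose L := N%:Z + m%:Z.
exists (encode f (truncate (- L) L u)); split.
  by have [] := code_in cc (@truncate_supported (- L) L u).
move=> i i_N; apply: encode_local => j j_i; rewrite /truncate ifT //.
by rewrite /L; lia.
Qed.

Lemma code_local_full : exists c : nat, forall u t,
  (forall i, t - c%:Z <= i <= t + c%:Z -> encode f u i = 0) -> u t = 0.
Proof.
have [c cP] := code_local ocM cc; exists c => u t u0.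
pose L := c%:Z + m%:Z.
have <- : truncate (t - L) (t + L) u t = u t.
  by rewrite /truncate ifT // /L; lia.
apply: (cP _ _ _ _ (@truncate_supported _ _ u)) => i i_c.
rewrite -[RHS](u0 i i_c); apply: encode_local => j j_i.
by rewrite /truncate ifT // /L; lia.
Qed.

Lemma encode_injective : injective (encode f).
Proof.
have [c cP] := code_local_full; move=> u v uv; apply/eqP.
rewrite -subr_eq0; apply/eqP/funext => t; apply: cP => i _.
by rewrite -[_ - _]/((u : biseqs K) - v) raddfB /= uv subrr.
Qed.

(** Density of the finite subcode. Control at N cuts off the future of x; the
    past is removed by subtracting a sequence obtained by control far enough
    to the left to be 0 on [-N, N]. *)
Lemma finite_approximation x (N : nat) : G x ->
  exists y, M y /\ agree (- N%:Z) N%:Z y x.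
Proof.
move=> Gx; have [l _ ctrl] := hoc.
have ctrl_at (t : int) z : G z -> exists y, [/\ G y, forall i, i <= t -> y i = z i &
    forall i, t + l%:Z < i -> y i = 0].
  move=> Gz; have [y [Gy yz y0 _]] := ctrl _ (group_shift_bshiftz hG t Gz).
  exists (bshiftz (- t) y); split; first exact: group_shift_bshiftz.
    by move=> i le_it; rewrite /bshiftz yz ?subr_le0 // /bshiftz subrK.
  move=> i lt_i; apply/eqP/negPn/negP => /y0 /=; lia.
have [x1 [Gx1 x1x x10]] := ctrl_at N%:Z x Gx.
have [z [Gz zx z0]] := ctrl_at (- N%:Z - l%:Z - 1) x1 Gx1.
exists (x1 - z); split; last first.
  by move=> i i_N; rewrite [LHS](biseqsB x1 z) x1x ?z0 ?subr0 //; lia.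
split; first exact: group_shiftB.
apply/finite_suppP; exists (- N%:Z - l%:Z), (N%:Z + l%:Z) => i i_N.
rewrite biseqsB; have [lt_i|le_i] := ltrP i (- N%:Z - l%:Z).
  by rewrite zx ?subrr //; lia.
by rewrite x10 ?z0 ?subrr //; lia.
Qed.

(** The finite decodings of better and better approximations of x agree from
    some point on at each position, by locality of decoding; their limit
    encodes x. *)
Lemma encode_onto x : G x -> exists u, encode f u = x.
Proof.
move=> Gx; have [c cP] := code_local_full.
have /choice[u uP] (N : nat) : exists u, agree (- N%:Z) N%:Z (encode f u) x.
  have [y [My yx]] := finite_approximation N Gx.
  by have [a [b [u [_ uy]]]] := code_onto cc My; exists u; rewrite uy.
have u_stable N t : `|t| + c%:Z <= N%:Z -> u N t = u (`|t|%N + c)%N t.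
  move=> le_N; apply/eqP; rewrite -subr_eq0 -[_ - _]/(((u N : biseqs K) - u (`|t|%N + c)%N) t).
  apply/eqP/cP => i i_c; rewrite raddfB /= biseqsB.
  by rewrite uP ?uP ?subrr //; lia.
exists (fun t => u (`|t|%N + c)%N t); apply/funext => i.
pose N := (`|i|%N + m + c)%N; rewrite -[RHS](uP N); last by lia.
by apply: encode_local => j j_i; rewrite -(u_stable N) //; lia.
Qed.

Definition decode (x : int -> H) : int -> K := xget 0 [set u | encode f u = x].

Lemma decodeK x : G x -> encode f (decode x) = x.
Proof. by move=> /encode_onto[u ux]; rewrite /decode; case: xgetP => // /(_ u). Qed.

Lemma encodeK : cancel (encode f) decode.
Proof. by move=> u; apply/encode_injective/decodeK/encode_in. Qed.

Lemma range_encode : range (encode f) = G.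
Proof.
apply/seteqP; split=> [_ [u _ <-]|x Gx]; first exact: encode_in.
by exists (decode x); last exact: decodeK.
Qed.

Lemma encode_continuous : continuous (encode f : biseq K -> biseq H).
Proof. exact: (local_continuous (c := m)) encode_local. Qed.

Lemma decode_continuous :
  {within (G : set (biseq H)), continuous (decode : biseq H -> biseq K)}.
Proof.
have [c cP] := code_local_full; apply: (local_continuous_within (c := c)).
move=> x y t Gx Gy xy; apply/eqP.
rewrite -subr_eq0 -[_ - _]/(((decode x : biseqs K) - decode y) t).
apply/eqP/cP => i i_c; rewrite raddfB /= !decodeK // biseqsB xy ?subrr //.
Qed.

Lemma encode_finite_support :
  encode f @` [set u | finite_set (supp u)] = finite_subcode G.
Proof.
apply/seteqP; split=> [_ [u /finite_suppP[a [b uab]] <-]|x].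
  exact: (code_in cc uab).
by move=> /(code_onto cc)[a [b [u [uab ux]]]]; exists u => //; apply/finite_suppP; exists a, b.
Qed.

Lemma conjugacy_decode : conjugacy G (@full_group_shift K) decode (encode f).
Proof.
split.
- apply/seteqP; split=> // u _; exists (encode f u); first exact: encode_in.
  exact: encodeK.
- exact: decodeK.
- move=> x y Gx Gy; apply: encode_injective.
  rewrite decodeK; last exact: group_shiftD.
  by rewrite (raddfD (encode f)) /= !decodeK.
- exact: decode_continuous.
- by apply: continuous_subspaceT; apply: encode_continuous.
- move=> x Gx; apply: encode_injective.
  rewrite decodeK; last by rewrite -(group_shift_invariant hG); exists x.
  by rewrite -[bshift (decode x)]/(bshiftz 1 (decode x)) encode_bshiftz decodeK.
Qed.

End Conjugacy.

Theorem theorem1p3 (H : finZmodType) (G : set (int -> H))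
    (hG : group_shift G) (hoc : order_controllable G) :
  (exists (T : int -> topologicalZmodType) (Phi : (forall i, T i) -> (int -> H)),
      [/\ homomorphic_encoder G Phi, noncatastrophic G Phi &
          isomorphic_encoder G Phi]) /\
  (exists K : finZmodType, conjugate_shifts G (@full_group_shift K)).
Proof.
have [n ocM] := order_controllable_subcode hG hoc.
have [K [m [f cc]]] := oc_code ocM.
split; last first.
  exists K, (decode f), (encode f); exact: conjugacy_decode hG hoc ocM cc.
have enc : homomorphic_encoder (T := fun=> discrete_topology K) G (encode f).
  split; first exact: encode_continuous.
    by move=> x y; rewrite -[RHS](raddfD (encode f)).
  exact: range_encode hG hoc ocM cc.
exists (fun=> discrete_topology K), (encode f); split=> //.
  split; first exact: encode_injective ocM cc.
  exact: encode_finite_support cc.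
split=> //; exists (decode f); split; first exact: encodeK hG hoc ocM cc.
exact: decode_continuous hG hoc ocM cc.
Qed.
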